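(* Let $(F_n)_{n\ge0}$ and $(C_n)_{n\ge1}$ be sequences of subsets of $H_3(\mathbb R)$ satisfying: (I) $(F_n)_{n\ge 0}$ is a Følner sequence in $H_3(\mathbb R)$; (II) each $C_n$ is finite and $\#C_n>1$; (III) $F_nC_{n+1}\subset F_{n+1}$; (IV) $F_nc\cap F_nc'=\emptyset$ for all $c\ne c'\in C_{n+1}$; and suppose that $\prod_{n=0}^\infty\frac{\lambda(F_{n+1})}{\lambda(F_n)\,\#C_{n+1}}=\infty$. Let $T$ be the $(C,F)$-action of $H_3(\mathbb R)$ associated with $(C_{n+1},F_n)_{n\ge0}$, acting on the infinite measure space $(X,\mathfrak B,\mu)$. Suppose that the following conditions are satisfied for all $n$: (i) $F_nF_n^{-1}F_nC_{n+1}\subset F_{n+1}$, (ii) the sets $F_nc_1c_2^{-1}F_n^{-1}$, $c_1\neq c_2\in C_{n+1}$, and $F_nF_n^{-1}$ are all pairwise disjoint, and (iii) $\#C_n\to\infty$ as $n\to\infty$. Then $T$ is mixing.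
   Context: $H_3(\mathbb R)$ is the locally compact group of $3\times3$ upper triangular real matrices with ones on the diagonal; it is unimodular and $\lambda$ is a Haar measure on it. For subsets $E,F$ of the group, $EF=\{ef\mid e\in E,f\in F\}$ and $E^{-1}=\{e^{-1}\mid e\in E\}$. A Følner sequence is a sequence of relatively compact Borel subsets $F_n$ of positive Haar measure with $\lambda(gF_n\triangle F_n)/\lambda(F_n)\to0$ for every $g$. $(C,F)$-action: put $X_n=F_n\times\prod_{k>n}C_k$ with the product Borel structure, and embed $X_n$ into $X_{n+1}$ by $(f_n,c_{n+1},c_{n+2},\dots)\mapsto(f_nc_{n+1},c_{n+2},\dots)$. Let $X=\bigcup_nX_n$ be the resulting increasing union (a standard Borel space). Let $\kappa_k$ be the uniform probability on $C_k$, let $\nu_n=(\#C_1\cdots\#C_n)^{-1}\lambda\restriction F_n$, and let $\mu$ be the $\sigma$-finite measure on $X$ whose restriction to $X_n$ is $\nu_n\times\kappa_{n+1}\times\kappa_{n+2}\times\cdots$ for each $n$ (these are compatible with the embeddings). The total mass $\mu(X)$ is finite if and only if $\prod_{n}\frac{\lambda(F_{n+1})}{\lambda(F_n)\#C_{n+1}}<\infty$. The action $T=(T_g)$ is the $\mu$-preserving action defined, for each $g$ and $\mu$-a.e. $x\in X$, by $T_g(f_n,c_{n+1},c_{n+2},\dots)=(gf_n,c_{n+1},c_{n+2},\dots)$, where $x=(f_n,c_{n+1},\dots)\in X_n$ and $n$ is large enough that $gf_n\in F_n$. An infinite measure preserving action $T$ of $H_3(\mathbb R)$ is called mixing (or $0$-type)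 if $\mu(T_gA\cap B)\to0$ as $g\to\infty$ for all $A,B\subset X$ of finite measure. *)

(* Defs.v *)
From HB Require Import structures.
From mathcomp Require Import all_boot all_order all_algebra.
From mathcomp Require Import finmap generic_quotient.
From mathcomp Require Import all_classical all_reals all_analysis.

Set Implicit Arguments.
Unset Strict Implicit.
Unset Printing Implicit Defensive.

Import Order.TTheory GRing.Theory Num.Theory.
Import numFieldNormedType.Exports.

Local Open Scope classical_set_scope.
Local Open Scope ring_scope.

Section Heisenberg.
Variable R : realType.

Definition unitriangular : set 'M[R]_3 :=
  [set A | forall i j : 'I_3, (j <= i)%N -> A i j = (i == j)%:R].

(* The group H_3(R), with the topology induced from 'M[R]_3. *)
Definition heisenberg : Type := set_type unitriangular.

HB.instance Definition _ := Choice.on heisenberg.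
HB.instance Definition _ := Topological.on heisenberg.

Lemma heisenbergP (x : heisenberg) : unitriangular (val x).
Proof. by case: x => x /= /set_mem. Qed.

Lemma unitriangular1 : unitriangular 1%:M.
Proof. by move=> i j _; rewrite mxE. Qed.

Lemma unitriangularM (A B : 'M[R]_3) :
  unitriangular A -> unitriangular B -> unitriangular (A *m B).
Proof.
move=> hA hB i j ji; rewrite mxE (bigD1 i) //= big1 => [|k ki].
  by rewrite addr0 (hA i i) // eqxx mul1r hB.
have [ltki|] := ltnP k i.
  by rewrite hA ?(ltnW ltki)// eq_sym (negbTE ki) mul0r.
rewrite leq_eqVlt eq_sym => /orP[/eqP/val_inj kiE|ltik].
  by rewrite kiE eqxx in ki.
rewrite hB ?(leq_trans ji (ltnW ltik))//.
suff -> : (k == j) = false by rewrite mulr0.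
by apply/negbTE/eqP => kj; move: ltik; rewrite kj ltnNge ji.
Qed.

Lemma unitriangular_unitmx (A : 'M[R]_3) : unitriangular A -> A \in unitmx.
Proof.
move=> hA; rewrite unitmxE -det_tr det_trig.
  by rewrite big1 ?unitr1// => i _; rewrite mxE hA// eqxx.
apply/is_trig_mxP => i j ij; rewrite mxE hA ?(ltnW ij)//.
by apply/eqP; rewrite pnatr_eq0 eqb0 -val_eqE/= gtn_eqF.
Qed.

Lemma unitriangularV (A : 'M[R]_3) : unitriangular A -> unitriangular (invmx A).
Proof.
move=> hA; have /matrixP AV := mulmxV (unitriangular_unitmx hA).
have {AV}E i j : \sum_k A i k * invmx A k j = (i == j)%:R.
  by have := AV i j; rewrite !mxE.
suff H m (i j : 'I_3) : (2 - i <= m)%N -> (j <= i)%N ->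
    invmx A i j = (i == j)%:R by move=> i j; exact: (H 2 i j (leq_subr _ _)).
elim: m i j => [|m IH] i j im ji.
  have i2 : i = ord_max.
    by apply/val_inj/eqP; rewrite eqn_leq/= -ltnS ltn_ord/= -subn_eq0 -leqn0.
  have := E i j; rewrite (bigD1 i)//= hA// eqxx mul1r big1 ?addr0// => k ki.
  rewrite hA; last by rewrite i2/= -ltnS ltn_ord.
  by rewrite eq_sym (negbTE ki) mul0r.
have := E i j; rewrite (bigD1 i)//= hA// eqxx mul1r big1 ?addr0// => k ki.
have [ltki|] := ltnP k i.
  by rewrite hA ?(ltnW ltki)// eq_sym (negbTE ki) mul0r.
rewrite leq_eqVlt eq_sym => /orP[/eqP/val_inj kiE|ltik].
  by rewrite kiE eqxx in ki.
have jk := leq_ltn_trans ji ltik.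
rewrite IH ?(ltnW jk)//; last first.
  rewrite -ltnS (leq_trans _ im)// ltn_sub2l// .
  by rewrite (leq_trans ltik)// -ltnS ltn_ord.
by rewrite -val_eqE/= gtn_eqF// mulr0.
Qed.

Definition heisenberg_one : heisenberg := SigSub (mem_set unitriangular1).
Definition heisenberg_mul (x y : heisenberg) : heisenberg :=
  SigSub (mem_set (unitriangularM (heisenbergP x) (heisenbergP y))).
Definition heisenberg_inv (x : heisenberg) : heisenberg :=
  SigSub (mem_set (unitriangularV (heisenbergP x))).

Fact heisenberg_mulA : associative heisenberg_mul.
Proof. by move=> x y z; apply/val_inj; rewrite /= mulmxA. Qed.
Fact heisenberg_mul1 : left_id heisenberg_one heisenberg_mul.
Proof. by move=> x; apply/val_inj; rewrite /= mul1mx. Qed.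
Fact heisenberg_mulr1 : right_id heisenberg_one heisenberg_mul.
Proof. by move=> x; apply/val_inj; rewrite /= mulmx1. Qed.
Fact heisenberg_mulV : left_inverse heisenberg_one heisenberg_inv heisenberg_mul.
Proof.
move=> x; apply/val_inj; rewrite /= mulVmx//.
exact/unitriangular_unitmx/heisenbergP.
Qed.
Fact heisenberg_mulrV :
  right_inverse heisenberg_one heisenberg_inv heisenberg_mul.
Proof.
move=> x; apply/val_inj; rewrite /= mulmxV//.
exact/unitriangular_unitmx/heisenbergP.
Qed.

HB.instance Definition _ := isGroup.Build heisenberg heisenberg_mulA
  heisenberg_mul1 heisenberg_mulr1 heisenberg_mulV heisenberg_mulrV.
HB.instance Definition _ := isPointed.Build heisenberg heisenberg_one.

(* The measurable sets of H_3(R) are its Borel sets. *)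
HB.instance Definition _ := Measurable.copy heisenberg
  (g_sigma_algebraType (@open heisenberg)).

End Heisenberg.

Section GroupSets.
Variable G : groupType.
Implicit Types E F : set G.

Definition setmul E F : set G := [set (e * f)%g | e in E & f in F].
Definition setinv E : set G := [set (e^-1)%g | e in E].

End GroupSets.

(* The filter describing "g goes to infinity": the sets containing the
   complement of a compact set. *)
Definition at_infinity (T : topologicalType) : set_system T :=
  filter_from (@compact T) (fun K => ~` K).
Arguments at_infinity T : clear implicits.

Section CF.
Variable R : realType.
Local Notation H := (heisenberg R).
Local Open Scope ereal_scope.

(* Regularity is not required: every locally finite Borel measure on H_3(R)
   is regular. *)
Record is_Haar (lambda : {measure set H -> \bar R}) : Prop := {
  Haar_neq0 : lambda [set: H] != 0 ;
  Haar_compact : forall K : set H, compact K -> lambda K < +oo ;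
  Haar_invariant : forall (g : H) (A : set H), measurable A ->
    lambda (setmul [set g] A) = lambda A }.

Record Folner (lambda : set H -> \bar R) (F : nat -> set H) : Prop := {
  Folner_precompact : forall n, precompact (F n) ;
  Folner_measurable : forall n, measurable (F n) ;
  Folner_gt0 : forall n, 0 < lambda (F n) ;
  Folner_invariant : forall g : H,
    (fine (lambda (setmul [set g] (F n) `+` F n)) / fine (lambda (F n)))%R
      @[n --> \oo] --> (0 : R)%R }.

Definition set_card (A : set H) : nat := #|` fset_set A|.

(* The value C 0 is never used: the paper's sequence C starts at index 1. *)
Record CF_conditions (lambda : set H -> \bar R) (F C : nat -> set H) : Prop := {
  CF_Folner : Folner lambda F ;
  CF_finite : forall n, finite_set (C n.+1) /\ (1 < set_card (C n.+1))%N ;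
  CF_subset : forall n, setmul (F n) (C n.+1) `<=` F n.+1 ;
  CF_disjoint : forall n (c c' : H), C n.+1 c -> C n.+1 c' -> c <> c' ->
    setmul (F n) [set c] `&` setmul (F n) [set c'] = set0 }.

Section Levels.
Variables F C : nat -> set H.

(* A point (f_n, c_(n+1), c_(n+2), ...) of X_n is encoded as (f, c) with
   c j = c_(n+j+1). *)
Definition level (n : nat) : set (H * (nat -> H)) :=
  [set x | F n x.1 /\ forall j, C (n + j).+1 (x.2 j)].

(* The embedding of X_n into X_(n+1); its formula does not depend on n. *)
Definition embed (x : H * (nat -> H)) : H * (nat -> H) :=
  ((x.1 * x.2 0%N)%g, fun j => x.2 j.+1).

(* The product Borel structure on X_n: the sigma-algebra generated by the
   coordinates. *)
Definition level_measurable (n : nat) : set (set (level n)) :=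
  <<s [set B | exists2 A : set H, measurable A &
         B = [set x | A (val x).1] \/
         exists j, B = [set x | A ((val x).2 j)]] >>.

(* The increasing union of the X_n along the embeddings: two points of the
   disjoint union are identified when they have the same image in some X_k. *)
Definition CF_points := {n : nat & level n}.

Definition CF_push (k : nat) (p : CF_points) : H * (nat -> H) :=
  iter (k - tag p) embed (val (tagged p)).

Definition CF_rel (p q : CF_points) : bool :=
  `[< exists k, [/\ (tag p <= k)%N, (tag q <= k)%N &
                   CF_push k p = CF_push k q] >].

Lemma CF_push_iter (p : CF_points) k m : (tag p <= k)%N ->
  CF_push (m + k) p = iter m embed (CF_push k p).
Proof. by move=> pk; rewrite /CF_push -addnBA// iterD. Qed.

Fact CF_rel_refl : reflexive CF_rel.
Proof. by move=> p; apply/asboolP; exists (tag p). Qed.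

Fact CF_rel_sym : symmetric CF_rel.
Proof.
by move=> p q; apply/asboolP/asboolP => -[k [? ? ?]]; exists k.
Qed.

Fact CF_rel_trans : transitive CF_rel.
Proof.
move=> q p r /asboolP[k [pk qk pq]] /asboolP[l [ql rl qr]].
apply/asboolP; exists (l + k)%N; split.
- exact: leq_trans pk (leq_addl _ _).
- exact: leq_trans rl (leq_addr _ _).
- rewrite CF_push_iter// pq -CF_push_iter// addnC CF_push_iter// qr.
  by rewrite -CF_push_iter.
Qed.

Canonical CF_equiv := EquivRel CF_rel CF_rel_refl CF_rel_sym CF_rel_trans.

End Levels.

Definition CF_space (lambda : set H -> \bar R) (F C : nat -> set H)
  of CF_conditions lambda F C : Type := {eq_quot (CF_equiv F C)}%qT.

HB.instance Definition _ lambda F C (FC : CF_conditions lambda F C) :=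
  Choice.on (CF_space FC).

Section Space.
Variables (lambda : {measure set H -> \bar R}) (F C : nat -> set H).
Variable FC : CF_conditions lambda F C.
Local Notation X := (CF_space FC).

Definition inj_level (n : nat) (x : level F C n) : X :=
  \pi_({eq_quot (CF_equiv F C)})%qT (Tagged (fun n => set_type (level F C n)) x).

Lemma inj_levelE n m (x : level F C n) (y : level F C m) :
  inj_level x = inj_level y <->
  exists k, [/\ (n <= k)%N, (m <= k)%N &
    iter (k - n) embed (val x) = iter (k - m) embed (val y)].
Proof.
split=> [/eqmodP/asboolP[k [nk mk xy]]|[k [nk mk xy]]]; first by exists k.
by apply/eqmodP/asboolP; exists k.
Qed.

Lemma level_embed n (x : level F C n) : level F C n.+1 (embed (val x)).
Proof.
case: x => x /= /set_mem[Fx Cx]; split => /= [|j].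
  apply: (CF_subset FC); exists x.1 => //; exists (x.2 0%N) => //.
  by have := Cx 0%N; rewrite addn0.
by have := Cx j.+1; rewrite addnS -addSn.
Qed.

Lemma inj_level_embed n (x : level F C n) :
  inj_level (SigSub (mem_set (level_embed x)) : level F C n.+1) = inj_level x.
Proof.
by apply/inj_levelE; exists n.+1; split; rewrite ?leqnSn// subnn subSnn.
Qed.

Fact CF_space_nonempty : exists x : X, True.
Proof.
have /set0P[f Ff] : F 0%N != set0.
  apply/eqP => F0; have := Folner_gt0 (CF_Folner FC) 0.
  by rewrite F0 measure0 ltxx.
have /choice[c Cc] : forall n, exists c, C n.+1 c.
  move=> n; have [_] := CF_finite FC n; case: (eqVneq (C n.+1) set0).
    by rewrite /set_card => ->; rewrite fset_set0 cardfs0.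
  by move=> /set0P.
have L : level F C 0 (f, c) by split => // j; rewrite add0n; exact: Cc.
by exists (inj_level (SigSub (mem_set L) : level F C 0)).
Qed.

HB.instance Definition _ := isPointed.Build X (sval (cid CF_space_nonempty)).

(* The Borel structure of the union: a set is measurable when its trace on
   each X_n is. *)
Definition CF_measurable : set (set X) :=
  [set B | forall n, level_measurable (@inj_level n @^-1` B)].

Fact CF_measurable0 : CF_measurable set0.
Proof. by move=> n; rewrite preimage_set0; exact: sigma_algebra0. Qed.

Fact CF_measurableC (B : set X) : CF_measurable B -> CF_measurable (~` B).
Proof.
move=> mB n; rewrite preimage_setC -setTD.
exact: (sigma_algebraCD (mB n)).
Qed.

Fact CF_measurable_bigcup (B : (set X)^nat) :
  (forall i, CF_measurable (B i)) -> CF_measurable (\bigcup_i B i).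
Proof.
move=> mB n; rewrite preimage_bigcup.
by apply: sigma_algebra_bigcup => i; exact: mB.
Qed.

HB.instance Definition _ := @isMeasurable.Build default_measure_display X
  CF_measurable CF_measurable0 CF_measurableC CF_measurable_bigcup.

Definition nu (n : nat) (A : set H) : \bar R :=
  ((\prod_(1 <= k < n.+1) (set_card (C k))%:R)^-1)%:E * lambda (A `&` F n).

(* The uniform probability on C k. *)
Definition kappa (k : nat) (D : set H) : R :=
  ((set_card (D `&` C k))%:R / (set_card (C k))%:R)%R.

(* The restriction of mu to X_n is the product measure
   nu_n x kappa_(n+1) x kappa_(n+2) x ... , which is determined by its values
   on the measurable rectangles constraining finitely many coordinates. *)
Definition is_CF_measure (mu : {measure set X -> \bar R}) : Prop :=
  forall (n m : nat) (A : set H) (D : nat -> set H),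
    measurable A -> (forall j, measurable (D j)) ->
    mu (@inj_level n @`
      [set x | A (val x).1 /\ forall j, (j < m)%N -> D j ((val x).2 j)]) =
    nu n A * (\prod_(j < m) kappa (n + j).+1 (D j))%:E.

(* The graph of the partial transformation
   (f_n, c_(n+1), ...) |-> (g f_n, c_(n+1), ...), defined when g f_n is in
   F_n for some representation of the point. *)
Definition CF_graph (g : H) (x y : X) : Prop :=
  exists n (p q : level F C n), [/\ x = inj_level p, y = inj_level q &
    val q = ((g * (val p).1)%g, (val p).2)].

Lemma CF_graph_fun (g : H) (x y y' : X) :
  CF_graph g x y -> CF_graph g x y' -> y = y'.
Proof.
have E i (z : H * (nat -> H)) : iter i embed ((g * z.1)%g, z.2) =
    ((g * (iter i embed z).1)%g, (iter i embed z).2).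
  elim: i => [|i /= -> //]; first by case: z.
  by rewrite /embed/= mulgA.
move=> [n [p [q [-> -> qE]]]] [m [p' [q' [+ -> q'E]]]].
move=> /inj_levelE[k [nk mk pp']]; apply/inj_levelE; exists k; split=> //.
by rewrite qE q'E !E pp'.
Qed.

(* T_g, set to be the identity on the null set where the formula above does
   not apply. *)
Definition CF_action (g : H) (x : X) : X := xget x [set y | CF_graph g x y].

End Space.

Definition mixing d (X : measurableType d) (mu : {measure set X -> \bar R})
    (T : H -> X -> X) : Prop :=
  forall A B : set X, measurable A -> measurable B ->
    mu A < +oo -> mu B < +oo ->
    mu ((T g @` A) `&` B) @[g --> at_infinity H] --> 0.

End CF.

(* Main.v *)
From HB Require Import structures.
Require Import Defs.
From mathcomp Require Import all_boot all_order all_algebra.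
From mathcomp Require Import generic_quotient ring.
From mathcomp Require Import all_classical all_reals all_analysis.

(* Let g lie in F_(m+1) F_(m+1)^-1 but not in F_m F_m^-1, and n <= m.  By (i)
   T_g is given on X_n by left translation of the F_(m+2)-coordinate.  If x and
   T_g x are both in X_n, with C_(m+1), C_(m+2)-coordinates c, c' and d, d', then
   g = b d d' c'^-1 c^-1 a^-1 for some a, b in F_m.  Since g is in
   F_(m+1) F_(m+1)^-1, (ii) at level m+1 forces c' = d'; since g is not in
   F_m F_m^-1, c <> d; and then (ii) at level m says that (d, c) depends only on
   g.  Hence T_g X_n /\ X_n lies in a cylinder fixing one C_(m+1)-coordinate, so
   its measure is at most mu X_n / #C_(m+1).  As g goes to infinity so does m,
   and arbitrary A, B of finite measure are exhausted by their traces on X_n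
   because T_g does not increase the measure.

   Since T_g is the identity where the partial transformation is undefined, it
   need not be injective, but T_g A is the union of the image of the defined part
   and of the rest of A, so mu (T_g A) <= mu A. *)

Set Implicit Arguments.
Unset Strict Implicit.
Unset Printing Implicit Defensive.

Import Order.TTheory GRing.Theory Num.Theory.
Import numFieldNormedType.Exports.

Local Open Scope classical_set_scope.
Local Open Scope ring_scope.

(** * Topology and Borel structure of the Heisenberg group *)

Section HeisenbergTopology.
Variable R : realType.
Local Notation H := (heisenberg R).

Lemma heisenberg_val_continuous : continuous (fun x : H => val x).
Proof. exact: (@initial_continuous H 'M[R]_3 val). Qed.

Lemma heisenberg_coord_continuous (i j : 'I_3) :
  continuous (fun x : H => val x i j : R).
Proof.
move=> x; apply: (@continuous_comp _ _ _ (fun x : H => val x) (fun A : 'M[R]_3 => A i j)).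
  exact: heisenberg_val_continuous.
exact: coord_continuous.
Qed.

(** The topology of [H] is induced from the matrices, where a neighbourhood contains a product of
    neighbourhoods of the finitely many entries. *)
Lemma continuous_heisenberg (T : topologicalType) (f : T -> H) :
  (forall i j, continuous (fun t => val (f t) i j : R)) -> continuous f.
Proof.
move=> fc; apply/continuousP => A [B oB <-].
rewrite -comp_preimage; apply: open_comp => // t _.
move=> U [P tP PU].
have : \forall s \near t, forall i j, P i j (val (f s) i j).
  by apply: filter_forall => i; apply: filter_forall => j; exact/fc/tP.
by apply: filterS => s Ps; exact: PU.
Qed.

Lemma heisenberg_mul_continuous : continuous (fun p : H * H => (p.1 * p.2)%g).
Proof.
apply: continuous_heisenberg => i j.
rewrite (_ : (fun p => _) =
    (fun p : H * H => \sum_k (val p.1 i k * val p.2 k j) : R)); last first.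
  by apply/funext => p; rewrite /= mxE.
move=> p; apply: cvg_big => [|k _]; first exact: add_continuous.
apply: cvgM.
  apply: (@continuous_comp _ _ _ fst (fun x : H => val x i k : R)).
    exact: cvg_fst.
  exact: heisenberg_coord_continuous.
apply: (@continuous_comp _ _ _ snd (fun x : H => val x k j : R)).
  exact: cvg_snd.
exact: heisenberg_coord_continuous.
Qed.

(** Solving [x * x^-1 = 1] entry by entry shows that if [x] has entries [a], [b] next to the
    diagonal and [c] in the corner, then its inverse has [- a], [- b] and [a * b - c], all
    polynomial. *)
Lemma heisenberg_inv_continuous : continuous (fun x : H => (x^-1)%g).
Proof.
pose o : 'I_3 := inord 1.
have e3 (i : 'I_3) : [\/ i = ord0, i = o | i = ord_max].
  have := ltn_ord i; rewrite ltnS => i3.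
  case: (ltngtP i 1%N) => i1.
  - by apply: Or31; apply/val_inj/eqP; rewrite /= -leqn0 -ltnS.
  - by apply: Or33; apply/val_inj/eqP; rewrite /= eqn_leq i3.
  - by apply: Or32; apply/val_inj; rewrite /= inordK.
have o1 : (o : nat) = 1%N by rewrite inordK.
have E (x : H) i j : \sum_k val x i k * val (x^-1)%g k j = (i == j)%:R.
  have : val (x * x^-1)%g i j = val (1 : H)%g i j by rewrite mulgV.
  by rewrite !mxE.
have lo (x : H) (i j : 'I_3) : (j <= i)%N -> val x i j = (i == j)%:R.
  exact: heisenbergP.
have E3 (f : 'I_3 -> R) : \sum_k f k = f ord0 + f o + f ord_max.
  rewrite !big_ord_recr big_ord0 /= add0r.
  by congr (f _ + f _ + f _); apply/val_inj; rewrite /= ?inordK.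
have inv01 (x : H) : val (x^-1)%g ord0 o = - val x ord0 o.
  have := E x ord0 o; rewrite E3 (lo _ ord0 ord0)// (lo _ o o)// (lo _ ord_max o) ?o1//.
  rewrite -!val_eqE /= o1 mulr0 addr0 mul1r mulr1 => /eqP.
  by rewrite addr_eq0 => /eqP.
have inv12 (x : H) : val (x^-1)%g o ord_max = - val x o ord_max.
  have := E x o ord_max; rewrite E3 (lo _ o ord0) ?o1// (lo _ o o)// (lo _ ord_max ord_max)//.
  rewrite -!val_eqE /= o1 mul0r add0r mul1r mulr1 => /eqP.
  by rewrite addr_eq0 => /eqP.
have inv02 (x : H) : val (x^-1)%g ord0 ord_max =
    val x ord0 o * val x o ord_max - val x ord0 ord_max.
  have := E x ord0 ord_max; rewrite E3 (lo _ ord0 ord0)// (lo _ ord_max ord_max)//.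
  rewrite inv12 /= mul1r mulr1 mulrN => /eqP.
  by rewrite -addrA addr_eq0 opprD opprK => /eqP.
apply: continuous_heisenberg => i j.
have [ji|ij] := leqP j i.
  under eq_fun do rewrite lo//.
  exact: cst_continuous.
case: (e3 i) ij => ->; case: (e3 j) => -> //=; rewrite ?o1//= => _.
- under eq_fun do rewrite inv01.
  by move=> x; apply: (@cvgN _ _ _ (nbhs x) _ _ _ (@heisenberg_coord_continuous ord0 o x)).
- under eq_fun do rewrite inv02.
  move=> x; apply: (@cvgB _ _ _ (nbhs x) _ _ _ _ _ _
    (@heisenberg_coord_continuous ord0 ord_max x)).
  exact: (@cvgM _ _ (nbhs x) _ _ _ _ _ (@heisenberg_coord_continuous ord0 o x)
    (@heisenberg_coord_continuous o ord_max x)).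
- under eq_fun do rewrite inv12.
  by move=> x; apply: (@cvgN _ _ _ (nbhs x) _ _ _ (@heisenberg_coord_continuous o ord_max x)).
Qed.

Lemma heisenberg_hausdorff : hausdorff_space H.
Proof.
move=> x y xy; apply/val_inj/(@norm_hausdorff R 'M[R]_3) => A B xA yB.
have [z []] := xy _ _ (heisenberg_val_continuous xA) (heisenberg_val_continuous yB).
by exists (val z).
Qed.

Lemma continuous_heisenberg_measurable (f : H -> H) (A : set H) :
  continuous f -> measurable A -> measurable (f @^-1` A).
Proof.
move=> /continuousP fc mA; rewrite -[X in measurable X]setTI.
apply: (@measurability _ _ H H setT f open) => //.
by move=> _ [B oB <-]; rewrite setTI; apply: sub_sigma_algebra; exact: fc.
Qed.

Lemma measurable_lmul (g : H) (A : set H) :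
  measurable A -> measurable [set x | A (g * x)%g].
Proof.
apply: (@continuous_heisenberg_measurable (fun x => g * x)%g) => x.
apply: (@continuous_comp _ _ _ (fun x : H => (g, x)) (fun p : H * H => p.1 * p.2)%g).
  exact: (@cvg_pair _ _ _ (nbhs x) (nbhs g) (nbhs x) _ _ _ _ _ (cvg_cst _) cvg_id).
exact: heisenberg_mul_continuous.
Qed.

Lemma measurable_rmul (g : H) (A : set H) :
  measurable A -> measurable [set x | A (x * g)%g].
Proof.
apply: (@continuous_heisenberg_measurable (fun x => x * g)%g) => x.
apply: (@continuous_comp _ _ _ (fun x : H => (x, g)) (fun p : H * H => p.1 * p.2)%g).
  exact: (@cvg_pair _ _ _ (nbhs x) (nbhs x) (nbhs g) _ _ _ _ _ cvg_id (cvg_cst _)).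
exact: heisenberg_mul_continuous.
Qed.

Lemma setmul1E (g : H) (A : set H) : setmul [set g] A = [set x | A (g^-1 * x)%g].
Proof.
apply/seteqP; split => [_ [_ -> [a Aa <-]]|x /= Ax]; first by rewrite /= mulKg.
by exists g => //; exists (g^-1 * x)%g => //; rewrite mulVKg.
Qed.

Lemma closed_heisenberg_measurable (A : set H) : closed A -> measurable A.
Proof.
move=> cA; rewrite -[A]setCK; apply: measurableC.
by apply: sub_sigma_algebra; exact: closed_openC.
Qed.

Lemma measurable_heisenberg1 (x : H) : measurable [set x].
Proof.
apply: closed_heisenberg_measurable; apply: accessible_closed_set1.
exact/hausdorff_accessible/heisenberg_hausdorff.
Qed.

Lemma measurable_finite_heisenberg (A : set H) : finite_set A -> measurable A.
Proof.
move=> fA; rewrite -[A]image_id -bigcup_imset1.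
apply: fin_bigcup_measurable => // x _; exact: measurable_heisenberg1.
Qed.

(** The compact set is the image of the square of the closure under the continuous map sending
    [(a, b)] to [a * b^-1]. This is how letting [g] go to infinity pushes it out of any given
    [F_M F_M^-1]. *)
Lemma precompact_setmul_setinv (A : set H) : precompact A ->
  exists2 K, compact K & setmul A (setinv A) `<=` K.
Proof.
rewrite precompactE => cA.
exists ((fun p : H * H => (p.1 * p.2^-1)%g) @` (closure A `*` closure A)).
  apply: continuous_compact; last exact: compact_setX.
  apply/continuous_subspaceT => p.
  apply: (@continuous_comp _ _ _ (fun p : H * H => (p.1, p.2^-1)%g)
    (fun p : H * H => p.1 * p.2)%g); last exact: heisenberg_mul_continuous.
  apply: (@cvg_pair _ _ _ (nbhs p) (nbhs p.1) (nbhs (p.2^-1)%g)); first exact: cvg_fst.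
  apply: (@continuous_comp _ _ _ snd (fun x : H => x^-1)%g); first exact: cvg_snd.
  exact: heisenberg_inv_continuous.
move=> _ [a Aa [_ [b Ab <-] <-]]; exists (a, b) => //.
by split; exact: subset_closure.
Qed.

Lemma precompact_Haar_lty (lambda : {measure set H -> \bar R}) (A : set H) :
  is_Haar lambda -> precompact A -> measurable A -> (lambda A < +oo)%E.
Proof.
move=> hl; rewrite precompactE => cA mA.
apply: le_lt_trans (Haar_compact hl cA); apply: le_measure; rewrite ?inE//.
  by apply: closed_heisenberg_measurable; exact: closed_closure.
exact: subset_closure.
Qed.

End HeisenbergTopology.

(** * The measurable space of codes and left translation on it *)

Section Codes.
Variable R : realType.
Local Notation H := (heisenberg R).

Definition coord_sets : set (set (H * (nat -> H))) :=
  [set B | exists2 A : set H, measurable A &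
     B = [set x | A x.1] \/ exists j, B = [set x | A (x.2 j)]].

(* The points of X_n are handled as elements of the ambient H * (nat -> H),
   with its product sigma-algebra, rather than of the subtype level n. *)
Definition cf_code : Type := g_sigma_algebraType coord_sets.
HB.instance Definition _ := Measurable.copy cf_code (g_sigma_algebraType coord_sets).
HB.instance Definition _ := Pointed.on cf_code.

Lemma measurable_code1 (A : set H) : measurable A ->
  measurable ([set x | A x.1] : set cf_code).
Proof. by move=> mA; apply: sub_sigma_algebra; exists A => //; left. Qed.

Lemma measurable_code2 j (A : set H) : measurable A ->
  measurable ([set x | A (x.2 j)] : set cf_code).
Proof. by move=> mA; apply: sub_sigma_algebra; exists A => //; right; exists j. Qed.

Lemma measurable_code_preimage (f : cf_code -> cf_code) :
  (forall A : set H, measurable A -> measurable ([set x | A (f x).1] : set cf_code)) ->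
  (forall j (A : set H), measurable A ->
    measurable ([set x | A ((f x).2 j)] : set cf_code)) ->
  forall S : set cf_code, measurable S -> measurable (f @^-1` S).
Proof.
move=> f1 f2 S mS; rewrite -[X in measurable X]setTI.
apply: (@measurability _ _ cf_code cf_code setT f coord_sets) => //.
move=> _ [_ [A mA [->|[j ->]]] <-]; rewrite setTI.
  exact: f1.
exact: f2.
Qed.

Definition rectangle (A : set H) (D : nat -> set H) m : set cf_code :=
  [set x | A x.1 /\ forall j, (j < m)%N -> D j (x.2 j)].

Lemma measurable_rectangle (A : set H) (D : nat -> set H) m :
  measurable A -> (forall j, measurable (D j)) -> measurable (rectangle A D m).
Proof.
move=> mA mD.
rewrite (_ : rectangle A D m = [set x | A x.1] `&`
    \bigcap_(j in [set j | (j < m)%N]) [set x | D j (x.2 j)]); last first.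
  by apply/seteqP; split => x [].
apply: measurableI; first exact: measurable_code1.
by apply: bigcap_measurableType => j _; exact: measurable_code2.
Qed.

Definition ltrans (g : H) (x : cf_code) : cf_code := ((g * x.1)%g, x.2).

Lemma ltransK g : cancel (ltrans g) (ltrans g^-1%g).
Proof. by case=> x c; rewrite /ltrans /= mulKg. Qed.

Lemma ltransVK g : cancel (ltrans g^-1%g) (ltrans g).
Proof. by case=> x c; rewrite /ltrans /= mulVKg. Qed.

Lemma measurable_ltrans g (S : set cf_code) : measurable S ->
  measurable (ltrans g @^-1` S).
Proof.
apply: measurable_code_preimage => [A mA|j A mA].
  exact: (@measurable_code1 [set x | A (g * x)%g] (measurable_lmul g mA)).
exact: measurable_code2.
Qed.

(** The embedding multiplies on the right and the translation on the left, so they commute by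
    associativity. *)
Lemma embed_ltrans g (x : cf_code) k :
  iter k (@embed R) (ltrans g x) = ltrans g (iter k (@embed R) x).
Proof. by elim: k => //= k ->; rewrite /embed/ltrans/= mulgA. Qed.

Lemma iter_embed2 k (x : cf_code) j : (iter k (@embed R) x).2 j = x.2 (k + j)%N.
Proof. by elim: k j => //= k IH j; rewrite IH addnS. Qed.

End Codes.

(** * The map from codes to the quotient space, its injectivity and its measurable sets *)

Section Projection.
Variables (R : realType) (lambda : {measure set (heisenberg R) -> \bar R}).
Local Notation H := (heisenberg R).
Variables (F C : nat -> set H).
Variable FC : CF_conditions lambda F C.
Local Notation X := (CF_space FC).
Local Notation cf_code := (cf_code R).
Local Notation embed := (@embed R).
Local Notation L n := (level F C n : set cf_code).

Lemma embed_level n (x : cf_code) : L n x -> L n.+1 (embed x).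
Proof. by move=> Lx; exact: (@level_embed _ _ _ _ FC n (SigSub (mem_set Lx))). Qed.

Lemma iter_embed_level n k (x : cf_code) : L n x -> L (k + n) (iter k embed x).
Proof. by move=> Lx; elim: k => //= k IH; rewrite addSn; exact: embed_level. Qed.

(** By the disjointness of the sets [F_n c], the product [f * c 0] determines [c 0]; cancelling it
    on the right recovers [f]. *)
Lemma embed_inj n (x y : cf_code) : L n x -> L n y -> embed x = embed y -> x = y.
Proof.
case: x y => [f c] [f' c'] [/= Ff Cc] [/= Ff' Cc'] [] e1 e2.
(* Injecting the equality of pairs goes down to the underlying matrices; [val_inj] brings it back to
   the group. *)
have {}e1 : (f * c 0%N)%g = (f' * c' 0%N)%g by exact/val_inj.
have c0 : c 0%N = c' 0%N.
  apply: contrapT => cc'.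
  have := CF_disjoint FC (n := n) (c := c 0%N) (c' := c' 0%N).
  have := Cc 0%N; have := Cc' 0%N; rewrite addn0 => h' h /(_ h h' cc').
  apply/eqP/set0P; exists (f * c 0%N)%g; split.
    by exists f => //; exists (c 0%N).
  by rewrite e1; exists f' => //; exists (c' 0%N).
congr (_, _); first by move: e1; rewrite c0 => /mulIg.
by apply/funext => -[//|j]; have := congr1 (fun h => h j) e2.
Qed.

Lemma iter_embed_inj n k (x y : cf_code) : L n x -> L n y ->
  iter k embed x = iter k embed y -> x = y.
Proof.
move=> Lx Ly; elim: k => //= k IH e; apply: IH.
exact: (embed_inj (iter_embed_level k Lx) (iter_embed_level k Ly) e).
Qed.

(* The junk value point is taken off X_n. *)
Definition cf_proj n (x : cf_code) : X :=
  if pselect (L n x) is left Lx then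
    @inj_level _ _ _ _ FC n (SigSub (mem_set Lx)) else point.

Lemma proj_val n (p : level F C n) : cf_proj n (val p) = inj_level FC p.
Proof.
rewrite /cf_proj; case: pselect => [Lp|]; first by congr inj_level; exact: val_inj.
by case; case: p => p /= /set_mem.
Qed.

Lemma proj_inj n (x y : cf_code) : L n x -> L n y -> cf_proj n x = cf_proj n y -> x = y.
Proof.
move=> Lx Ly; rewrite -[x]/(val (SigSub (mem_set Lx) : level F C n)).
rewrite -[y]/(val (SigSub (mem_set Ly) : level F C n)) !proj_val.
by move=> /inj_levelE[k [_ _ e]]; exact: (iter_embed_inj Lx Ly e).
Qed.

Lemma proj_embed n (x : cf_code) : L n x -> cf_proj n.+1 (embed x) = cf_proj n x.
Proof.
move=> Lx; rewrite -[x]/(val (SigSub (mem_set Lx) : level F C n)) proj_val.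
rewrite -inj_level_embed -proj_val //.
Qed.

Lemma proj_iter n k (x : cf_code) : L n x -> cf_proj (k + n) (iter k embed x) = cf_proj n x.
Proof.
move=> Lx; elim: k => //= k <-; rewrite addSn proj_embed//.
exact: iter_embed_level.
Qed.

Lemma proj_surj (a : X) : exists n x, L n x /\ a = cf_proj n x.
Proof.
rewrite -[a]reprK; case: (repr a) => n p; exists n, (val p).
by split; [case: p => p /= /set_mem|rewrite proj_val].
Qed.

Lemma measurable_level n : measurable (L n).
Proof.
rewrite (_ : L n = [set x | F n x.1] `&` \bigcap_j [set x | C (n + j).+1 (x.2 j)]).
  apply: measurableI.
  by apply: measurable_code1; exact: (Folner_measurable (CF_Folner FC)).
  apply: bigcap_measurableType => j _; apply: measurable_code2.
  exact: (measurable_finite_heisenberg (CF_finite FC _).1).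
by apply/seteqP; split => [x [Fx Cx]|x [Fx Cx]]; split => // j; [move=> _|]; exact: Cx.
Qed.

(** The generators on [level F C n] are the preimages under [val] of those on codes, so the
    sigma-algebra is the trace one; since [L n] is itself measurable, trace sets are measurable in
    the ambient space. *)
Lemma level_measurableE n (D : set (level F C n)) :
  level_measurable D <-> measurable (val @` D : set cf_code).
Proof.
have LE : L n = val @` [set: level F C n].
  apply/seteqP; split => [x Lx|_ [p _ <-]].
    by exists (SigSub (mem_set Lx)).
  by case: p => p /= /set_mem.
have mL := measurable_level n.
have -> : level_measurable D = preimage_set_system setT
    (val : level F C n -> cf_code) (measurable : set (set cf_code)) D.
  rewrite -(@g_sigma_preimageE _ cf_code).
  congr (<<s _ >> D); apply/seteqP.
  split => [_ [A mA [->|[j ->]]]|_ [_ [A mA [->|[j ->]]] <-]].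
  - by exists [set x | A x.1]; [exists A => //; left|rewrite setTI].
  - by exists [set x | A (x.2 j)]; [exists A => //; right; exists j|rewrite setTI].
  - by exists A => //; left; rewrite setTI.
  - by exists A => //; right; exists j; rewrite setTI.
split=> [[S mS <-]|mD]; last first.
  exists (val @` D) => //; rewrite setTI; apply/seteqP; split => [p [q Dq /val_inj <-]//|p Dp].
  by exists p.
rewrite setTI; rewrite (_ : _ @` _ = L n `&` S); first exact: measurableI.
apply/seteqP; split => [_ [p Sp <-]|x [Lx Sx]].
  by split=> //; case: p Sp => p /= /set_mem.
by exists (SigSub (mem_set Lx)).
Qed.

Lemma level_val n (p : level F C n) : L n (val p).
Proof. by case: p => p /= /set_mem. Qed.

Lemma val_preimage_inj_level n (B : set X) :
  val @` (@inj_level _ _ _ _ FC n @^-1` B) = L n `&` cf_proj n @^-1` B.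
Proof.
apply/seteqP; split => [_ [p Bp <-]|x [Lx Bx]].
  by split; [exact: level_val|rewrite /= proj_val].
by exists (SigSub (mem_set Lx)) => //=; rewrite -proj_val.
Qed.

Lemma measurable_proj (B : set X) :
  measurable B <-> forall n, measurable (L n `&` cf_proj n @^-1` B).
Proof.
rewrite -[measurable B]/(CF_measurable B).
by split=> mB n; have := mB n; rewrite -val_preimage_inj_level => /level_measurableE.
Qed.

Lemma CF_measure_rectangle (mu : {measure set X -> \bar R}) : is_CF_measure mu ->
  forall n m (A : set H) (D : nat -> set H),
    measurable A -> (forall j, measurable (D j)) ->
  mu (cf_proj n @` (L n `&` rectangle A D m)) =
    (nu lambda F C n A * (\prod_(j < m) kappa C (n + j).+1 (D j))%:E)%E.
Proof.
move=> h n m A D mA mD; rewrite -(h n m A D mA mD); congr (mu _).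
apply/seteqP; split => [_ [x [Lx Sx] <-]|_ [p Sp <-]].
  by exists (SigSub (mem_set Lx)) => //; rewrite -proj_val.
by exists (val p); rewrite ?proj_val//; split=> //; exact: level_val.
Qed.

End Projection.

(** * Rectangles as a generating pi-system, and uniqueness of measures on them *)

Section Rectangles.
Variable R : realType.
Local Notation H := (heisenberg R).
Local Notation cf_code := (cf_code R).

Definition rectangles : set (set cf_code) :=
  [set S | exists A D m, [/\ measurable A, (forall j, measurable (D j)) &
     S = rectangle A D m]].

Lemma setI_closed_rectangles : setI_closed rectangles.
Proof.
move=> _ _ [A [D [m [mA mD ->]]]] [A' [D' [m' [mA' mD' ->]]]].
(* Padding with the whole group lets two rectangles of different lengths be described with the
   common length [maxn m m']. *)
pose E k (D : nat -> set H) j := if (j < k)%N then D j else setT.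
have mE k (D0 : nat -> set H) j : (forall j, measurable (D0 j)) -> measurable (E k D0 j).
  by move=> mD0; rewrite /E; case: ifP.
exists (A `&` A'), (fun j => E m D j `&` E m' D' j), (maxn m m'); split.
- exact: measurableI.
- by move=> j; apply: measurableI; exact: mE.
apply/seteqP; split => [x [[Ax Dx] [Ax' Dx']]|x [[Ax Ax'] h]].
  split=> // j _; split; rewrite /E; case: ifP => // jm; [exact: Dx|exact: Dx'].
split; split => // j jm.
  by have [] := h j (leq_trans jm (leq_maxl _ _)); rewrite /E jm.
by have [] := h j (leq_trans jm (leq_maxr _ _)); rewrite /E jm.
Qed.

Lemma measurable_codeE : (measurable : set (set cf_code)) = <<s rectangles >>.
Proof.
apply/seteqP; split; last first.
  apply: smallest_sub; first exact: sigma_algebra_measurable.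
  by move=> _ [A [D [m [mA mD ->]]]]; exact: measurable_rectangle.
apply: smallest_sub; first exact: smallest_sigma_algebra.
move=> _ [A mA [->|[j ->]]].
  apply: sub_sigma_algebra; exists A, (fun=> setT), 0%N; split => //.
  by apply/seteqP; split => x // [].
apply: sub_sigma_algebra; exists setT, (fun i => if i == j then A else setT), j.+1; split => //.
  by move=> i; case: ifP.
apply/seteqP; split => [x Ax|x [_ /(_ j (ltnSn j))]]; last by rewrite eqxx.
by split => // i _; case: eqP => // ->.
Qed.

(** A pi-lambda argument for the two set functions that send [S] to the measure of the image of its
    trace on [D]. Injectivity makes images respect complements in [D] and disjointness; finiteness
    of the total mass allows the subtraction in the complement step. *)
Lemma measure_image_unique d (T : measurableType d) (mu : {measure set T -> \bar R})
    (f g : cf_code -> T) (D : set cf_code) :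
  {in D &, injective f} -> {in D &, injective g} ->
  (forall S, measurable S -> measurable (f @` (D `&` S))) ->
  (forall S, measurable S -> measurable (g @` (D `&` S))) ->
  (mu (f @` D) < +oo)%E ->
  (forall S, rectangles S -> mu (f @` (D `&` S)) = mu (g @` (D `&` S))) ->
  forall S, measurable S -> mu (f @` (D `&` S)) = mu (g @` (D `&` S)).
Proof.
move=> finj ginj mf mg foo fgR S.
have fgT : mu (f @` D) = mu (g @` D).
  rewrite -(setIT D); apply: fgR; exists setT, (fun=> setT), 0%N; split => //.
  by apply/seteqP; split => x // [].
have imC (h : cf_code -> T) (A : set cf_code) : {in D &, injective h} ->
    h @` (D `&` ~` A) = h @` D `\` h @` (D `&` A).
  move=> hinj; apply/seteqP; split => [_ [x [Dx Ax] <-]|_ [[x Dx <-] nA]].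
    split; first by exists x.
    by move=> [y [Dy Ay] /hinj]; rewrite !inE => /(_ Dy Dx) yx; apply: Ax; rewrite -yx.
  by exists x => //; split => // Ax; apply: nA; exists x.
have imI (h : cf_code -> T) (A B : set cf_code) : {in D &, injective h} ->
    h @` (D `&` A) `&` h @` (D `&` B) = h @` (D `&` (A `&` B)).
  move=> hinj; apply/seteqP; split => [_ [[x [Dx Ax] <-] [y [Dy By] /hinj]]|].
    by rewrite !inE => /(_ Dy Dx) yx; exists x => //; split => //; split => //; rewrite -yx.
  by move=> _ [x [Dx [Ax Bx]] <-]; split; exists x.
have mD (h : cf_code -> T) : (forall S, measurable S -> measurable (h @` (D `&` S))) ->
    measurable (h @` D).
  by move=> /(_ _ measurableT); rewrite setIT.
rewrite measurable_codeE => mS.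
pose P := [set S : set cf_code | mu (f @` (D `&` S)) = mu (g @` (D `&` S))].
apply: (@dynkin_induction _ cf_code rectangles P) mS => //.
- exact: measurable_codeE.
- exact: setI_closed_rectangles.
- by rewrite /P /= setIT.
- move=> A mA; rewrite /P /= => e; rewrite !imC// !measureD//.
  + have sI (h : cf_code -> T) : h @` (D `&` A) `<=` h @` D.
      by apply: image_subset; exact: subIsetl.
    by rewrite (setIidr (sI f)) (setIidr (sI g)); congr (_ - _)%E.
  + exact: mD.
  + exact: mg.
  + by move: foo; rewrite fgT.
  + exact: mD.
  + exact: mf.
- move=> A mA tA; rewrite /P /= => e; rewrite !setI_bigcupr !image_bigcup.
  have tI (h : cf_code -> T) : {in D &, injective h} ->
      trivIset setT (fun i => h @` (D `&` A i)).
    move=> hinj i j _ _ [t]; rewrite imI// => -[x [_ Ax] _].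
    by apply: tA => //; exists x.
  rewrite (measure_bigcup mu setT (fun i => f @` (D `&` A i)))//; last 2 first.
  + by move=> i _; exact: mf.
  + exact: tI.
  rewrite (measure_bigcup mu setT (fun i => g @` (D `&` A i)))//; last 2 first.
  + by move=> i _; exact: mg.
  + exact: tI.
  by apply: eq_eseriesr => i _; exact: e.
Qed.

End Rectangles.

(** * Measurability of images of codes, under the embeddings and in the quotient *)

Section Dynamics.
Variables (R : realType) (lambda : {measure set (heisenberg R) -> \bar R}).
Local Notation H := (heisenberg R).
Variables (F C : nat -> set H).
Variable FC : CF_conditions lambda F C.
Local Notation X := (CF_space FC).
Local Notation cf_code := (cf_code R).
Local Notation embed := (@embed R).
Local Notation L n := (level F C n : set cf_code).
Local Notation cf_proj := (cf_proj FC).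
Local Notation T := (CF_action (FC := FC)).

(** On [L n] the coordinate [x.2 0] takes finitely many values, and once it is fixed to [c] the
    embedding is right translation by the constant [c] with a shift. *)
Lemma measurable_embed_preimage n (S : set cf_code) : measurable S ->
  measurable (L n `&` embed @^-1` S).
Proof.
move=> mS.
pose e (c : H) (x : cf_code) : cf_code := ((x.1 * c)%g, fun j => x.2 j.+1).
rewrite (_ : _ `&` _ = L n `&` \bigcup_(c in C n.+1) ([set x | x.2 0%N = c] `&` e c @^-1` S)).
  apply: measurableI; first exact: (measurable_level FC).
  apply: fin_bigcup_measurable => [|c _]; first exact: (CF_finite FC n).1.
  apply: measurableI.
    exact: (@measurable_code2 _ 0 [set c] (measurable_heisenberg1 c)).
  apply: (measurable_code_preimage _ _ mS) => [A mA|j A mA].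
    exact: (@measurable_code1 _ [set x | A (x * c)%g] (measurable_rmul c mA)).
  exact: (@measurable_code2 _ j.+1 A mA).
apply/seteqP; split => [x [Lx Sx]|x [Lx [c _ [<- Sx]]]]; split => //.
by exists (x.2 0%N) => //; have := Lx.2 0%N; rewrite addn0.
Qed.

Lemma measurable_embed_image n (S : set cf_code) : measurable S -> S `<=` L n ->
  measurable (embed @` S : set cf_code).
Proof.
move=> mS SL.
(* [e c] is the inverse branch of the embedding that puts [c] back as the first tail coordinate; the
   image is a finite union of preimages under these branches. *)
pose e (c : H) (x : cf_code) : cf_code :=
  ((x.1 * c^-1)%g, fun j => if j is j'.+1 then x.2 j' else c).
rewrite (_ : _ @` _ = \bigcup_(c in C n.+1) (e c @^-1` S)).
  apply: fin_bigcup_measurable => [|c _]; first exact: (CF_finite FC n).1.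
  apply: (measurable_code_preimage _ _ mS) => [A mA|[|j] A mA].
  - exact: (@measurable_code1 _ [set x | A (x * c^-1)%g] (measurable_rmul _ mA)).
  (* Coordinate 0 of [e c x] is the constant [c], so the preimage is everything or empty. *)
  - by rewrite /=; have [Ac|Ac] := pselect (A c);
      [rewrite (_ : [set _ | _] = setT) | rewrite (_ : [set _ | _] = set0)] => //;
      apply/seteqP; split.
  - exact: measurable_code2.
apply/seteqP; split => [_ [x Sx <-]|x [c Cc Sx]].
  exists (x.2 0%N); first by have := (SL _ Sx).2 0%N; rewrite addn0.
  rewrite /preimage /= (_ : e _ _ = x)//; case: x Sx => x c Sx.
  by rewrite /e/= mulgK; congr pair; apply/funext => -[].
by exists (e c x) => //; case: x Sx => x d Sx; rewrite /embed /e/= mulgVK.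
Qed.

(** Measurability in the union is tested on each level [k]: the trace is an iterated image under the
    embedding if [n <= k], and an iterated preimage if [k <= n]. *)
Lemma measurable_proj_image n (S : set cf_code) : measurable S -> S `<=` L n ->
  measurable (cf_proj n @` S).
Proof.
move=> mS SL; apply/measurable_proj => k.
have [nk|/ltnW kn] := leqP n k.
  rewrite -(subnK nk); move: (k - n)%N => {nk}d.
  rewrite (_ : _ `&` _ = (iter d embed @` S : set cf_code)); last first.
    apply/seteqP; split => [x [Lx [y Sy]]|_ [x Sx <-]]; last first.
      split; first exact: (iter_embed_level FC d (SL _ Sx)).
      by exists x => //; rewrite proj_iter//; exact: SL.
    rewrite -(proj_iter FC d (SL _ Sy)) => /(proj_inj _ Lx) <-; first by exists y.
    exact: (iter_embed_level FC d (SL _ Sy)).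
  suff [] : measurable (iter d embed @` S : set cf_code) /\ iter d embed @` S `<=` L (d + n) by [].
  elim: d => [|d [mI IL]] /=; first by rewrite image_id.
  rewrite (_ : _ @` S = embed @` (iter d embed @` S)); last by rewrite image_comp.
  split.
    exact: (measurable_embed_image mI IL).
  by move=> _ [x Ix <-]; rewrite addSn; exact: (embed_level FC (IL _ Ix)).
(* Now the lower level [k], with [n = d + k]; injectivity at level [n] identifies the trace with a
   preimage. *)
rewrite -(subnK kn) in mS SL *; move: (n - k)%N mS SL => {n kn}d mS SL.
rewrite (_ : _ `&` _ = L k `&` (iter d embed) @^-1` S); last first.
  apply/seteqP; split => [x [Lx [y Sy]]|x [Lx Sx]]; last first.
    by split => //; exists (iter d embed x) => //; rewrite proj_iter.
  rewrite -(proj_iter FC d Lx) => /(@proj_inj _ _ _ _ _ _ _ _ (SL _ Sy)) yE.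
  split => //=; rewrite -yE//; exact: (iter_embed_level FC d Lx).
elim: d k {SL} => [|d IH] k; first by apply: measurableI => //; exact: (measurable_level FC).
rewrite (_ : _ `&` _ = L k `&` embed @^-1` (L k.+1 `&` iter d embed @^-1` S)).
  exact: measurable_embed_preimage.
apply/seteqP; split => [x [Lx]|x [Lx [_]]]; rewrite /preimage/=.
  by rewrite -iterS iterSr => Sx; split => //; split => //; exact: (embed_level FC Lx).
by rewrite -iterSr.
Qed.

End Dynamics.

(** * The partial translations and their effect on the measure *)

Section Action.
Variables (R : realType) (lambda : {measure set (heisenberg R) -> \bar R}).
Local Notation H := (heisenberg R).
Variables (F C : nat -> set H).
Variable FC : CF_conditions lambda F C.
Local Notation X := (CF_space FC).
Local Notation cf_code := (cf_code R).
Local Notation embed := (@embed R).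
Local Notation L n := (level F C n : set cf_code).
Local Notation cf_proj := (cf_proj FC).
Local Notation T := (CF_action (FC := FC)).


Definition cf_dom (g : H) n : set cf_code := L n `&` ltrans g @^-1` L n.

Lemma dom_iter g n k x : cf_dom g n x -> cf_dom g (k + n) (iter k embed x).
Proof.
move=> [Lx Lgx]; split; first exact: (iter_embed_level FC k Lx).
by rewrite /preimage /= -embed_ltrans; exact: (iter_embed_level FC k Lgx).
Qed.

Lemma measurable_dom g n : measurable (cf_dom g n).
Proof.
apply: measurableI; first exact: (measurable_level FC).
exact: measurable_ltrans (measurable_level FC n).
Qed.

Lemma CF_graph_proj g n x : cf_dom g n x ->
  CF_graph g (cf_proj n x) (cf_proj n (ltrans g x)).
Proof.
move=> [Lx Lgx0]; have Lgx : L n (ltrans g x) := Lgx0.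
exists n, (SigSub (mem_set Lx)), (SigSub (mem_set Lgx)).
by split => //; rewrite -proj_val.
Qed.

Lemma CF_action_proj g n x : cf_dom g n x -> T g (cf_proj n x) = cf_proj n (ltrans g x).
Proof.
move=> /CF_graph_proj gx; apply: xget_unique => [|y]; first exact: gx.
by move=> gy; exact: CF_graph_fun gy gx.
Qed.

Lemma CF_action_id g (a : X) : ~ (exists n, (cf_proj n @` cf_dom g n) a) -> T g a = a.
Proof.
move=> na; apply: xgetPN => y [n [p [q [aE _ qE]]]]; apply: na.
exists n, (val p); last by rewrite proj_val.
by split; [exact: level_val|rewrite /preimage /= /ltrans -qE; exact: level_val].
Qed.

Lemma measurable_ltrans_image g (S : set cf_code) : measurable S ->
  measurable (ltrans g @` S : set cf_code).
Proof.
move=> mS; rewrite (_ : _ @` _ = ltrans g^-1%g @^-1` S); first exact: measurable_ltrans.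
apply/seteqP; split => [_ [x Sx <-]|x Sx]; first by rewrite /preimage /= ltransK.
by exists (ltrans g^-1%g x) => //; rewrite ltransVK.
Qed.

Hypothesis Haar_lambda : is_Haar lambda.
Variable mu : {measure set X -> \bar R}.
Hypothesis CF_mu : is_CF_measure mu.

Lemma Folner_lty n : (lambda (F n) < +oo)%E.
Proof.
exact: (precompact_Haar_lty Haar_lambda (Folner_precompact (CF_Folner FC) n)
  (Folner_measurable (CF_Folner FC) n)).
Qed.

Lemma CF_measure_level_lty n : (mu (cf_proj n @` L n) < +oo)%E.
Proof.
have -> : L n = L n `&` rectangle setT (fun=> setT) 0%N.
  by apply/seteqP; split => x // [].
rewrite (CF_measure_rectangle CF_mu)// big_ord0 mule1 /nu setTI.
apply: lte_mul_pinfty; rewrite ?lee_fin ?invr_ge0 ?prodr_ge0//.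
exact: Folner_lty.
Qed.

(** By uniqueness it suffices to treat rectangles. There the translation leaves the tail, hence the
    [kappa] factors, unchanged, and the base factor is handled by left invariance of [lambda]. *)
Lemma CF_measure_ltrans g n (S : set cf_code) : measurable S ->
  mu (cf_proj n @` (cf_dom g n `&` S)) = mu (cf_proj n @` (ltrans g @` (cf_dom g n `&` S))).
Proof.
move=> mS; rewrite image_comp.
have mF := Folner_measurable (CF_Folner FC).
have gdom : ltrans g @` cf_dom g n `<=` L n by move=> _ [x [_ Lgx] <-].
apply: (measure_image_unique (mu := mu) (f := cf_proj n) (g := cf_proj n \o ltrans g)) mS.
- move=> x y /set_mem[Lx _] /set_mem[Ly _]; exact: (proj_inj Lx Ly).
- move=> x y /set_mem[_ Lx] /set_mem[_ Ly] /(proj_inj Lx Ly).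
  exact: (can_inj (ltransK g)).
- move=> S0 mS0; apply: (@measurable_proj_image _ _ _ _ FC n); last by move=> x [[]].
  by apply: measurableI => //; exact: measurable_dom.
- move=> S0 mS0; rewrite -image_comp; apply: (@measurable_proj_image _ _ _ _ FC n).
    by apply: measurable_ltrans_image; apply: measurableI => //; exact: measurable_dom.
  by move=> _ [x [Dx _] <-]; apply: gdom; exists x.
- apply: le_lt_trans (CF_measure_level_lty n); apply: le_measure; rewrite ?inE.
  + by apply: (@measurable_proj_image _ _ _ _ FC n); [exact: measurable_dom|move=> x []].
  + by apply: (@measurable_proj_image _ _ _ _ FC n); [exact: (measurable_level FC)|].
  + by apply: image_subset => x [].
move=> _ [A [D [m [mA mD ->]]]].
(* [A1] absorbs the domain condition into the base, and [A2] is the translate by [g] of the part of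
   [A] in [F n]; inside [F n], [A2] is the translate of [A1]. *)
pose A1 := A `&` [set x | F n (g * x)%g].
pose A2 := [set x | A (g^-1 * x)%g] `&` [set x | F n (g^-1 * x)%g].
have -> : cf_dom g n `&` rectangle A D m = L n `&` rectangle A1 D m.
  apply/seteqP; split => [x [[Lx Lgx] [Ax Dx]]|x [Lx [[Ax Fx] Dx]]].
    by split => //; split => //; split => //; exact: Lgx.1.
  by split; split => //; split => //; exact: Lx.2.
have -> : (cf_proj n \o ltrans g) @` (L n `&` rectangle A1 D m) =
    cf_proj n @` (L n `&` rectangle A2 D m).
  rewrite -image_comp; congr (_ @` _).
  apply/seteqP; split => [_ [x [[Fx Cx] [[Ax Fgx] Dx]] <-]|x [[Fx Cx] [[Ax Fgx] Dx]]].
    by split => //; split => //; split; rewrite /= mulKg.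
  exists (ltrans g^-1%g x); last by rewrite ltransVK.
  by split => //; split => //; split => //=; rewrite mulVKg.
have mA1 : measurable A1 by apply: measurableI => //; exact: (measurable_lmul g).
have mA2 : measurable A2.
  by apply: measurableI; [exact: (measurable_lmul _ mA)|exact: (measurable_lmul _ (mF n))].
rewrite !(CF_measure_rectangle CF_mu)//; congr (_ * _)%E; congr (_ * _)%E.
rewrite -(Haar_invariant Haar_lambda g); last exact: measurableI.
congr (lambda _); rewrite setmul1E; apply/seteqP; split => x.
  by move=> [[Ax]] /=; rewrite mulVKg.
by move=> [[Ax Fgx] Fx]; do 2 split => //=; rewrite mulVKg.
Qed.

Lemma nondecreasing_proj_dom g : nondecreasing_seq (fun n => cf_proj n @` cf_dom g n).
Proof.
move=> n k nk; apply/subsetPset => _ [x Dx <-].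
rewrite -(proj_iter FC (k - n) Dx.1) subnK//.
by exists (iter (k - n) embed x) => //; have := dom_iter (k - n) Dx; rewrite subnK.
Qed.

(** Preservation holds level by level and passes to the increasing union [D] of the domains by
    continuity from below. The image of the part in [D] may meet the fixed part outside [D], hence
    an inequality. *)
Lemma CF_action_image g (A : set X) : measurable A ->
  measurable (T g @` A) /\ (mu (T g @` A) <= mu A)%E.
Proof.
move=> mA.
pose D := \bigcup_n (cf_proj n @` cf_dom g n).
pose S n := cf_dom g n `&` (L n `&` cf_proj n @^-1` A).
have SL n : S n `<=` L n by move=> x [[]].
have gSL n : ltrans g @` S n `<=` L n by move=> _ [x [[_ Lgx] _] <-].
have mS n : measurable (S n).
  by apply: measurableI; [exact: measurable_dom|exact: (measurable_proj _).1].
have mgS n : measurable (cf_proj n @` (ltrans g @` S n)).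
  exact: (measurable_proj_image FC (measurable_ltrans_image g (mS n)) (gSL n)).
have SE n : cf_proj n @` S n = A `&` cf_proj n @` cf_dom g n.
  apply/seteqP; split => [a [x [Dx [Lx Ax]] xE]|a [Ax [x Dx xE]]].
    rewrite -xE; by split => //; exists x.
  by exists x => //; split => //; split; [exact: Dx.1|rewrite /preimage /= xE].
have gSE n : cf_proj n @` (ltrans g @` S n) = T g @` (A `&` cf_proj n @` cf_dom g n).
  rewrite -SE !image_comp; apply: eq_imagel => x [Dx _] /=.
  by rewrite CF_action_proj.
have mD : measurable D.
  apply: bigcup_measurable => n _.
  apply: (@measurable_proj_image _ _ _ _ FC n); first exact: measurable_dom.
  by move=> x [].
have ADE : A `&` D = \bigcup_n cf_proj n @` S n.
  by rewrite /D setI_bigcupr; apply: eq_bigcupr => n _; rewrite SE.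
have TADE : T g @` (A `&` D) = \bigcup_n cf_proj n @` (ltrans g @` S n).
  by rewrite /D setI_bigcupr image_bigcup; apply: eq_bigcupr => n _; rewrite gSE.
have mTAD : measurable (T g @` (A `&` D)) by rewrite TADE; exact: bigcup_measurable.
have muTAD : mu (T g @` (A `&` D)) = mu (A `&` D).
  have ndS : nondecreasing_seq (fun n => A `&` cf_proj n @` cf_dom g n).
    move=> n k nk; apply/subsetPset; apply: setIS; apply/subsetPset.
    exact: (nondecreasing_proj_dom g nk).
  have cS : mu (cf_proj n @` S n) @[n --> \oo] --> mu (A `&` D).
    rewrite ADE; apply: nondecreasing_cvg_mu.
    - by move=> n; exact: (measurable_proj_image FC (mS n) (SL n)).
    - by rewrite -ADE; exact: measurableI.
    - by move=> n k nk; rewrite !SE; exact: ndS.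
  have cgS : mu (cf_proj n @` (ltrans g @` S n)) @[n --> \oo] --> mu (T g @` (A `&` D)).
    rewrite TADE; apply: nondecreasing_cvg_mu => //.
    - by rewrite -TADE.
    - move=> n k nk; rewrite !gSE; apply/subsetPset; apply: image_subset.
      by apply/subsetPset; exact: ndS.
  apply: (cvg_unique _ cgS); first exact: ereal_hausdorff.
  rewrite (_ : (fun n => _) = fun n => mu (cf_proj n @` S n)) //.
  apply/funext => n; apply/esym; apply: CF_measure_ltrans.
  exact: (measurable_proj _).1.
have TDE : T g @` A = (A `\` D) `|` T g @` (A `&` D).
  have TA a : ~ D a -> T g a = a.
    by move=> Da; apply: CF_action_id => -[n Dn]; apply: Da; exists n.
  apply/seteqP; split => [_ [a Aa <-]|b [[Ab Db]|[a [Aa _] <-]]].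
  - have [Da|Da] := pselect (D a); first by right; exists a.
    by left; rewrite TA.
  - by exists b => //; rewrite TA.
  - by exists a.
have mAD : measurable (A `&` D) by exact: measurableI.
have mAdD : measurable (A `\` D) by exact: measurableD.
split; first by rewrite TDE; exact: measurableU.
rewrite TDE; have muTAD_le : (mu (T g @` (A `&` D)) <= mu (A `&` D))%E by rewrite muTAD.
apply: (le_trans (measureU2 mu mAdD mTAD)).
rewrite [leRHS](measureDI mu mA mD).
exact: leeD.
Qed.

End Action.

(** * Return sets of the levels and the mixing estimate *)

Section Mixing.
Variables (R : realType) (lambda : {measure set (heisenberg R) -> \bar R}).
Local Notation H := (heisenberg R).
Variables (F C : nat -> set H).
Variable FC : CF_conditions lambda F C.
Local Notation X := (CF_space FC).
Local Notation cf_code := (cf_code R).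
Local Notation embed := (@embed R).
Local Notation L n := (level F C n : set cf_code).
Local Notation cf_proj := (cf_proj FC).
Local Notation T := (CF_action (FC := FC)).



Hypothesis Haar_lambda : is_Haar lambda.
Variable mu : {measure set X -> \bar R}.
Hypothesis CF_mu : is_CF_measure mu.

Local Notation FV n := (setmul (F n) (setinv (F n))).
Local Notation returns n c :=
  (setmul (setmul (F n) [set (c.1 * c.2^-1)%g]) (setinv (F n))).

Hypothesis cond_i : forall n,
  setmul (setmul (FV n) (F n)) (C n.+1) `<=` F n.+1.

(** For any [c] in [C k.+1], [a * b^-1 = (a * c) * (b * c)^-1], with [a * c] and [b * c] in
    [F k.+1]. *)
Lemma FV_mono n m : (n <= m)%N -> FV n `<=` FV m.
Proof.
move=> nm; rewrite -(subnK nm); elim: (m - n)%N => [//|k IH] g /IH {IH}.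
rewrite addSn; move: (k + n)%N => {}k [a Fa [_ [b Fb <-] <-]].
have [c Cc] : exists c, C k.+1 c.
  apply/set0P; apply/eqP => C0; have := (CF_finite FC k).2.
  by rewrite C0 /set_card fset_set0.
exists (a * c)%g; first by apply: (CF_subset FC); exists a => //; exists c.
exists (b * c)^-1%g; last by rewrite invgM mulgA mulgK.
by exists (b * c)%g => //; apply: (CF_subset FC); exists b => //; exists c.
Qed.

(** The new base [g * x.1 * x.2 0] lies in [F_m F_m^-1 F_m C_(m+1)], which [cond_i] places in
    [F m.+1]. *)
Lemma dom_of_FV g m x : FV m g -> L m x -> cf_dom F C g m.+1 (embed x).
Proof.
move=> Fg Lx; have Lex := embed_level FC Lx; split => //.
split; last exact: Lex.2.
apply: cond_i; exists (g * x.1)%g; first by exists g => //; exists x.1 => //; exact: Lx.1.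
by exists (x.2 0%N); [have := Lx.2 0%N; rewrite addn0|rewrite /= mulgA].
Qed.

Lemma measurable_proj_level n : measurable (cf_proj n @` L n).
Proof.
by apply: (@measurable_proj_image _ _ _ _ FC n) => //; exact: (measurable_level FC).
Qed.

Section Returns.
Variables (n m : nat) (g : H).
Hypothesis nm : (n <= m)%N.
Hypothesis gm1 : FV m.+1 g.
Hypothesis gm : ~ FV m g.
Hypothesis cond_ii1 : forall c : H * H, C m.+2 c.1 -> C m.+2 c.2 -> c.1 <> c.2 ->
  returns m.+1 c `&` FV m.+1 = set0.

(** Since tails of [L n] start at [C n.+1], the index [m - n] selects the coordinate in [C m.+1]. *)
Lemma CF_action_returns x y : L n x -> L n y -> T g (cf_proj n x) = cf_proj n y ->
  exists c, [/\ C m.+1 (y.2 (m - n)%N), C m.+1 c, y.2 (m - n)%N <> c &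
    returns m (y.2 (m - n)%N, c) g].
Proof.
move=> Lx Ly Txy.
have Lm z : L n z -> L m (iter (m - n) embed z).
  by move=> Lz; have := iter_embed_level FC (m - n) Lz; rewrite subnK.
have projm z : L n z -> cf_proj m.+2 (embed (embed (iter (m - n) embed z))) = cf_proj n z.
  move=> Lz; rewrite !proj_embed; [|exact: Lm|exact: (embed_level FC (Lm _ Lz))].
  by have := proj_iter FC (m - n) Lz; rewrite subnK.
have -> : y.2 (m - n)%N = (iter (m - n) embed y).2 0%N by rewrite iter_embed2 addn0.
have {Lm}[] := (Lm _ Lx, Lm _ Ly); have {projm}[] := (projm _ Lx, projm _ Ly).
(* Both points are now read at level [m]: [a], [b] lie in [F m], tail entries 0 in [C m.+1] and tail
   entries 1 in [C m.+2]. Two more embeddings reach level [m.+2], where translation by [g] is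
   defined. *)
move: (iter _ _ x) (iter _ _ y) => [a c] [b d].
rewrite -/(embed _) => projx projy La Lb.
have dx := dom_of_FV gm1 (embed_level FC La).
have /(proj_inj dx.2 (embed_level FC (embed_level FC Lb))) [] :
    cf_proj m.+2 (ltrans g (embed (embed (a, c)))) = cf_proj m.+2 (embed (embed (b, d))).
  by rewrite projy -Txy -projx CF_action_proj.
move=> e0 _.
have {e0}e : (g * (a * c 0%N * c 1%N) = b * d 0%N * d 1%N)%g by exact/val_inj.
have Fa : F m a := La.1.
have Fb : F m b := Lb.1.
have [Cc Cc1] : C m.+1 (c 0%N) /\ C m.+2 (c 1%N).
  by have := La.2 0%N; have := La.2 1%N; rewrite addn0 addn1.
have [Cd Cd1] : C m.+1 (d 0%N) /\ C m.+2 (d 1%N).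
  by have := Lb.2 0%N; have := Lb.2 1%N; rewrite addn0 addn1.
(* Otherwise [g], being [(b * d 0) * (d 1 / c 1) * (a * c 0)^-1], would lie in a return set disjoint
   from [FV m.+1]. *)
have c1d1 : d 1%N = c 1%N.
  apply: contrapT => dc; have : (returns m.+1 (d 1%N, c 1%N) `&` FV m.+1) g.
    split=> //; exists (b * d 0%N * (d 1%N / c 1%N))%g.
      exists (b * d 0%N)%g; last by exists (d 1%N / c 1%N)%g.
      by apply: (CF_subset FC); exists b => //; exists (d 0%N).
    exists (a * c 0%N)^-1%g.
      exists (a * c 0%N)%g => //.
      by apply: (CF_subset FC); exists a => //; exists (c 0%N).
    by rewrite mulgA -e !invgM !mulgA !mulgK.
  by rewrite cond_ii1.
move: e; rewrite c1d1 !mulgA => /mulIg; rewrite -mulgA => e.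
have gE : (g = b * (d 0%N / c 0%N) / a)%g by rewrite mulgA -e !mulgA !mulgK.
(* If [d 0 = c 0], then [g = b / a] would lie in [FV m], against [gm]. *)
exists (c 0%N); split => //= [dc|].
  by apply: gm; exists b => //; exists a^-1%g; [exists a|rewrite gE dc mulgV mulg1].
exists (b * (d 0%N / c 0%N))%g; last by exists a^-1%g; [exists a|rewrite gE].
by exists b => //; exists (d 0%N / c 0%N)%g.
Qed.

Hypothesis cond_ii2 :
  trivIset [set c | [/\ C m.+1 c.1, C m.+1 c.2 & c.1 <> c.2]]
    (fun c : H * H => returns m c).

Lemma CF_measure_returns : (mu (T g @` (cf_proj n @` L n) `&` cf_proj n @` L n) <=
  mu (cf_proj n @` L n) * (((set_card (C m.+1))%:R)^-1)%:E)%E.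
Proof.
set W := _ `&` _.
have mX := measurable_proj_level n.
have mW : measurable W.
  by apply: measurableI => //; exact: (CF_action_image Haar_lambda CF_mu g mX).1.
have [->|/set0P[w0 [[_ [x0 Lx0 <-] e0] [y0 Ly0 Ty0]]]] := eqVneq W set0.
  by rewrite measure0 mule_ge0// lee_fin invr_ge0.
rewrite -Ty0 in e0.
have [c0 [Cd0 Cc0 dc0 g0]] := CF_action_returns Lx0 Ly0 e0.
(* The cylinder is read off one arbitrary point of [W]; every other point of [W] yields a return set
   containing the same [g], so disjointness forces the same pair. *)
pose d := y0.2 (m - n)%N.
pose D j : set H := if j == (m - n)%N then [set d] else setT.
have mD j : measurable (D j).
  by rewrite /D; case: ifP => // _; exact: measurable_heisenberg1.
have WD : W `<=` cf_proj n @` (L n `&` rectangle setT D (m - n).+1).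
  move=> w [[_ [x Lx <-] e] [y Ly Ty]]; exists y => //; split=> //; split=> // j _.
  rewrite /D; case: eqP => // ->.
  rewrite -Ty in e; have [c [Cd Cc dc gc]] := CF_action_returns Lx Ly e.
  by have [] : (y.2 (m - n)%N, c) = (y0.2 (m - n)%N, c0)
    by apply: cond_ii2 => //; exists g.
apply: (@le_trans _ _ (mu (cf_proj n @` (L n `&` rectangle setT D (m - n).+1)))).
  apply: le_measure; rewrite ?inE//.
  apply: (@measurable_proj_image _ _ _ _ FC n); last by move=> x [].
  by apply: measurableI; [exact: (measurable_level FC)|exact: measurable_rectangle].
have -> : mu (cf_proj n @` L n) = nu lambda F C n setT.
  have LE : L n = L n `&` rectangle setT (fun=> setT) 0%N.
    by apply/seteqP; split => x // [].
  by rewrite [in LHS]LE (CF_measure_rectangle CF_mu)// big_ord0 mule1.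
rewrite (CF_measure_rectangle CF_mu)//.
have card_neq0 k : (set_card (C k.+1))%:R != 0 :> R.
  by rewrite pnatr_eq0 -lt0n (ltn_trans _ (CF_finite FC k).2).
(* All [kappa] factors before the last are 1; the last, at index [m - n], is that of a singleton of
   [C m.+1]. *)
rewrite big_ord_recr /= big1 ?mul1r => [|j _]; last first.
  by rewrite /D ltn_eqF// /kappa setTI divff.
rewrite /D eqxx /kappa subnKC// setIidl; last by move=> _ ->.
by rewrite {1}/set_card fset_set1 finmap.cardfs1 mul1r.
Qed.


End Returns.

(** If [g] is outside [FV n], then [g F_n] misses [F_n], so the symmetric difference contains [F_n]
    and the Følner ratio is at least 1. *)
Lemma Folner_exhausts g : exists n, FV n g.
Proof.
apply: contrapT => nFV.
have mF n := Folner_measurable (CF_Folner FC) n.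
have mgF n : measurable (setmul [set g] (F n)).
  by rewrite setmul1E; exact: measurable_lmul.
have Foo n := Folner_lty FC Haar_lambda n.
have gFoo n : (lambda (setmul [set g] (F n)) < +oo)%E by rewrite (Haar_invariant Haar_lambda).
have /cvgr_lt /(_ 1 ltr01)[n _ /(_ n (leqnn n)) /=] :=
  Folner_invariant (CF_Folner FC) g.
apply/negP; rewrite -leNgt.
have Fn0 : 0 < fine (lambda (F n)).
  by rewrite fine_gt0// (Folner_gt0 (CF_Folner FC)) Foo.
rewrite ler_pdivlMr// mul1r.
have mY : measurable (setmul [set g] (F n) `+` F n).
  by apply: measurableU; exact: measurableD.
have FY : F n `<=` setmul [set g] (F n) `+` F n.
  move=> a Fa; right; split => // -[_ -> [b Fb gb]]; apply: nFV; exists n.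
  by exists a => //; exists b^-1%g; [exists b|rewrite -gb mulgK].
apply: fine_le; rewrite ?ge0_fin_numE//.
  apply: (@le_lt_trans _ _ (lambda (setmul [set g] (F n) `|` F n))).
    apply: le_measure; rewrite ?inE//; first exact: measurableU.
    by move=> x [[]|[]]; [left|right].
  apply: (le_lt_trans (measureU2 lambda (mgF n) (mF n))).
  exact: (lte_add_pinfty (gFoo n) (Foo n)).
by apply: le_measure; rewrite ?inE.
Qed.

Lemma nondecreasing_proj_level : nondecreasing_seq (fun n => cf_proj n @` L n).
Proof.
move=> n k nk; apply/subsetPset => _ [x Lx <-].
rewrite -(proj_iter FC (k - n) Lx) subnK//.
by exists (iter (k - n) embed x) => //; have := iter_embed_level FC (k - n) Lx; rewrite subnK.
Qed.

(** The levels increase to the whole space, so continuity from above applies to the decreasing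
    remainders of a set of finite measure. *)
Lemma CF_measure_tail (A : set X) (e : R) : measurable A -> (mu A < +oo)%E ->
  0 < e -> \forall n \near \oo, (mu (A `\` cf_proj n @` L n) < e%:E)%E.
Proof.
move=> mA Aoo e0.
have mAn n : measurable (A `\` cf_proj n @` L n).
  by apply: measurableD => //; exact: measurable_proj_level.
have cap0 : \bigcap_n (A `\` cf_proj n @` L n) = set0.
  rewrite -subset0 => a aA; have [n [x [Lx ax]]] := proj_surj a.
  by have [_] := aA n Logic.I; apply; exists x.
have : mu (A `\` cf_proj n @` L n) @[n --> \oo] --> 0%E.
  rewrite -(measure0 mu) -cap0; apply: nonincreasing_cvg_mu => //.
  - apply: le_lt_trans Aoo; apply: le_measure; rewrite ?inE//.
  - by rewrite cap0.
  - move=> n k nk; apply/subsetPset; apply: setDS; apply/subsetPset.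
    exact: nondecreasing_proj_level.
move=> /(_ [set y | (y < e%:E)%E]); apply.
apply: (@filterS R (nbhs (0 : R)) _ _ _ _ (lt_nbhsl e0)) => r.
by rewrite /= lte_fin.
Qed.

Hypothesis cond_ii : forall n : nat,
  let P := [set c | [/\ C n.+1 c.1, C n.+1 c.2 & c.1 <> c.2]] in
  let E (c : H * H) := returns n c in
  trivIset P E /\ forall c, P c -> E c `&` FV n = set0.
Hypothesis cond_iii : set_card (C n) @[n --> \oo] --> \oo.

Lemma CF_mixing : mixing mu T.
Proof.
move=> A B mA mB Aoo Boo U U0.
have [e e0 eU] : exists2 e : R, 0 < e & forall y : \bar R,
    (0 <= y)%E -> (y < e%:E)%E -> U y.
  have /nbhs_ballP[e e0 eU] : nbhs (0 : R) [set r | U r%:E] := U0.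
  exists e => // -[r| |] //=; rewrite lee_fin lte_fin => r0 re.
  by apply: eU; rewrite /ball /= sub0r normrN ger0_norm.
have e3 : 0 < e / 3 by rewrite divr_gt0.
have [n [An Bn]] : exists n, (mu (A `\` cf_proj n @` L n) < (e / 3)%:E)%E /\
    (mu (B `\` cf_proj n @` L n) < (e / 3)%:E)%E.
  have [n [An Bn]] :=
    filter_ex (filterI (CF_measure_tail mA Aoo e3) (CF_measure_tail mB Boo e3)).
  by exists n.
set Xn := cf_proj n @` L n in An Bn.
have mXn : measurable Xn := measurable_proj_level n.
pose s := fine (mu Xn).
have sE : mu Xn = s%:E.
  by rewrite fineK// ge0_fin_numE//; exact: CF_measure_level_lty.
have s0 : 0 <= s by exact: fine_ge0.
(* From [M0] on, the cardinals exceed [s / (e / 3)], so that [s] divided by them is below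
   [e / 3]. *)
have [M0 _ M0P] := (cvgnyPge _).1 cond_iii (Num.trunc (s / (e / 3))).+1.
pose M := maxn n M0.
have [K cK FK] := precompact_setmul_setinv (Folner_precompact (CF_Folner FC) M).
exists K => // g /= Kg; apply: eU => //.
(* Take the least [k] with [g] in [FV k]. As [g] avoids [FV M], [k] exceeds [M]; with [k = m.+1],
   minimality keeps [g] out of [FV m]. *)
have ex : exists k, `[< FV k g >].
  by have [k gk] := Folner_exhausts g; exists k; exact/asboolP.
case: (ex_minnP ex) => k /asboolP gk kmin.
have Mk : (M < k)%N.
  rewrite ltnNge; apply/negP => kM; apply: Kg; apply: FK; exact: FV_mono gk.
case: k gk kmin Mk => // m gm1 kmin; rewrite ltnS => Mm.
have gm : ~ FV m g by move=> /asboolP /kmin; rewrite ltnn.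
have nm : (n <= m)%N := leq_trans (leq_maxl _ _) Mm.
have small : (mu (T g @` Xn `&` Xn) < (e / 3)%:E)%E.
  have ci (c : H * H) : C m.+2 c.1 -> C m.+2 c.2 -> c.1 <> c.2 ->
      returns m.+1 c `&` FV m.+1 = set0.
    by move=> ? ? ?; apply: (cond_ii m.+1).2.
  apply: le_lt_trans (CF_measure_returns nm gm1 gm ci (cond_ii m).1) _.
  rewrite -/Xn sE -EFinM lte_fin.
  have := M0P m.+1 (leq_trans (leq_trans (leq_maxr _ _) Mm) (leqnSn _)).
  rewrite /= -(ler_nat R) => /(lt_le_trans (truncnS_gt _)).
  rewrite ltr_pdivrMr// => sC.
  by rewrite ltr_pdivrMr 1?mulrC// ltr0n (ltn_trans _ (CF_finite FC m).2).
have [mTXn _] := CF_action_image Haar_lambda CF_mu g mXn.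
have [mTA TA] := CF_action_image Haar_lambda CF_mu g (measurableD mA mXn).
(* A point [T g a] of [B] is outside [Xn], or comes from [a] outside [Xn], or both [a] and [T g a]
   are in [Xn]; each case costs less than [e / 3]. *)
pose V := (T g @` Xn `&` Xn) `|` (T g @` (A `\` Xn) `|` (B `\` Xn)).
have mV0 : measurable (T g @` Xn `&` Xn) by exact: measurableI.
have mBX : measurable (B `\` Xn) by exact: measurableD.
have mV1 : measurable (T g @` (A `\` Xn) `|` (B `\` Xn)) by exact: measurableU.
have mTgA := (CF_action_image Haar_lambda CF_mu g mA).1.
apply: (@le_lt_trans _ _ (mu V)).
  apply: le_measure; rewrite ?inE//; [exact: measurableI|exact: measurableU|].
  move=> _ [[a Aa <-] Bb].
  have [Xb|Xb] := pselect (Xn (T g a)); last by right; right.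
  have [Xa|Xa] := pselect (Xn a); last by right; left; exists a.
  by left; split => //; exists a.
apply: (le_lt_trans (measureU2 mu mV0 mV1)).
have -> : e%:E = ((e / 3)%:E + ((e / 3)%:E + (e / 3)%:E))%E.
  by rewrite -!EFinD; congr EFin; field.
apply: lteD => //.
apply: (le_lt_trans (measureU2 mu mTA mBX)).
apply: lteD => //.
exact: le_lt_trans TA An.
Qed.

End Mixing.

Theorem theorem5p1 (R : realType)
    (lambda : {measure set (heisenberg R) -> \bar R})
    (Haar_lambda : is_Haar lambda)
    (F C : nat -> set (heisenberg R))
    (FC : CF_conditions lambda F C)
    (mu : {measure set (CF_space FC) -> \bar R})
    (CF_mu : is_CF_measure mu)
    (infinite_product :
      \prod_(0 <= n < N) (fine (lambda (F n.+1)) /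
        (fine (lambda (F n)) * (set_card (C n.+1))%:R)) @[N --> \oo] --> +oo)
    (cond_i : forall n : nat,
      setmul (setmul (setmul (F n) (setinv (F n))) (F n)) (C n.+1)
        `<=` F n.+1)
    (cond_ii : forall n : nat,
      let P := [set c | [/\ C n.+1 c.1, C n.+1 c.2 & c.1 <> c.2]] in
      let E c := setmul (setmul (F n) [set (c.1 * c.2^-1)%g]) (setinv (F n)) in
      trivIset P E /\
      forall c, P c -> E c `&` setmul (F n) (setinv (F n)) = set0)
    (cond_iii : set_card (C n) @[n --> \oo] --> \oo) :
  mixing mu (@CF_action R lambda F C FC).
Proof.
exact: (CF_mixing Haar_lambda CF_mu cond_i cond_ii cond_iii).
Qed.
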